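(* Let $n \in \mathbb{N}_+$ and let $f:\{0,1,2,\dots\} \to \mathbb{R}_{\ge 0}$ be any non-negative weight function (not necessarily monotone, and possibly taking the value $0$). Let $M_f \in \mathbb{R}^{n\times n}$ be the lower-triangular Toeplitz matrix with $M_f[i,j] = f(i-j)$ if $i \ge j$ and $M_f[i,j]=0$ otherwise. Let $m_f(x) = f(0) + f(1)x + \cdots + f(n-1)x^{n-1}$ and $\omega = e^{\pi \iota/n}$ (a primitive $2n$-th root of unity). Then there is an efficient algorithm that outputs a factorization $M_f = LR$ with $L$ a lower-triangular matrix such that, for all integers $p \in [2,\infty)$, $$\gamma_{(p)}(M_f) \le \mathrm{Tr}_p(L)\,\|R\|_{1\to 2} \le \frac{1}{2n^{1-1/p}} \sum_{k=0}^{2n-1} \left| m_f(\omega^k)\right|.$$ In particular, $\gamma_{2}(M_f) = \gamma_{(\infty)}(M_f) \le \frac{1}{2n}\sum_{k=0}^{2n-1}|m_f(\omega^k)|$ and $\gamma_{F}(M_f) = \gamma_{(2)}(M_f) \le \frac{1}{2\sqrt{n}}\sum_{k=0}^{2n-1}|m_f(\omega^k)|$.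
   Context: For a complex matrix $M\in\mathbb{C}^{d\times n}$, let $N = MM^*$ ($M^*$ the conjugate transpose). For $p \in [2,\infty)$ the generalized $p$-trace is $\mathrm{Tr}_p(M) = \left(\sum_{i=1}^d N[i,i]^{p/2}\right)^{1/p}$, and $\mathrm{Tr}_\infty(M) = \max_i N[i,i]^{1/2} = \|M\|_{2\to\infty}$ (the maximum Euclidean norm of a row). $\|C\|_{1\to 2}$ denotes the maximum Euclidean norm of a column of $C$. The factorization norm is $\gamma_{(p)}(M) = \inf\{\mathrm{Tr}_p(B)\,\|C\|_{1\to 2} : M = BC\}$ for $p \in [2,\infty]$; one writes $\gamma_F := \gamma_{(2)}$ and $\gamma_2 := \gamma_{(\infty)}$. *)

(* Defs.v *)
From HB Require Import structures.
From mathcomp Require Import all_boot all_order all_algebra.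
From mathcomp Require Import complex.
From mathcomp Require Import all_classical all_reals all_analysis.

Set Implicit Arguments.
Unset Strict Implicit.
Unset Printing Implicit Defensive.

Import Order.TTheory GRing.Theory Num.Theory.
Local Open Scope ring_scope.
Local Open Scope complex_scope.
Local Open Scope sesquilinear_scope.

Section FactorizationNorms.
Variable R : realType.

Definition cabs (z : R[i]) : R := ComplexField.Normc.normc z.

Definition gram_diag d n (M : 'M[R[i]]_(d, n)) (i : 'I_d) : R :=
  complex.Re ((M *m M ^t*) i i).

(* Meaningful for p in [2, +oo]; the value at -oo is a dummy. *)
Definition Tr_p (p : \bar R) d n (M : 'M[R[i]]_(d, n)) : R :=
  match p with
  | EFin q => (\sum_(i < d) gram_diag M i `^ (q / 2)) `^ q^-1
  | +oo%E => \big[Num.max/0]_(i < d) Num.sqrt (gram_diag M i)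
  | -oo%E => 0
  end.

Definition norm_1to2 m n (C : 'M[R[i]]_(m, n)) : R :=
  \big[Num.max/0]_(j < n) Num.sqrt (\sum_(i < m) cabs (C i j) ^+ 2).

(* The inner dimension k of the factorization is unrestricted. *)
Definition gamma_p (p : \bar R) d n (M : 'M[R[i]]_(d, n)) : R :=
  inf [set x : R | exists k (B : 'M[R[i]]_(d, k)) (C : 'M[R[i]]_(k, n)),
                     M = B *m C /\ x = Tr_p p B * norm_1to2 C].

Definition gamma_F d n (M : 'M[R[i]]_(d, n)) : R := gamma_p 2%:E M.
Definition gamma_2 d n (M : 'M[R[i]]_(d, n)) : R := gamma_p +oo%E M.

Definition M_ (f : nat -> R) n : 'M[R]_n :=
  \matrix_(i < n, j < n) (if (j <= i)%N then f (i - j)%N else 0).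

Definition m_ (f : nat -> R) n : {poly R[i]} := \poly_(k < n) (f k)%:C.

(* exp (iota * pi / k), where pi / 0 = 0 *)
Definition exp_ipi (k : nat) : R[i] :=
  cos (pi / k%:R) +i* sin (pi / k%:R).

End FactorizationNorms.

(* Algorithms are programs for a unit-cost algebraic random access machine
   whose memory cells, addressed by natural numbers, hold complex numbers.
   A program is a fixed piece of syntax, independent of the size and of the
   entries of the input. Control flow is restricted to bounded loops. *)

(* [IVar k] is the k-th innermost loop counter; the outermost "counter" is the
   size of the input. [ISub] is truncated subtraction. *)
Inductive iexp :=
  | IVar of nat
  | IConst of nat
  | IAdd of iexp & iexp
  | ISub of iexp & iexp
  | IMul of iexp & iexp.

Inductive cexp :=
  | CCell of iexp
  | CNat of iexp
  | CRoot of iexp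
  | CAdd of cexp & cexp
  | COpp of cexp
  | CMul of cexp & cexp
  | CInv of cexp
  | CConj of cexp
  | CSqrt of cexp.

Inductive prog :=
  | Store of iexp & cexp
  | Seq of prog & prog
  | For of iexp & prog.

Fixpoint ieval (env : seq nat) (a : iexp) : nat :=
  match a with
  | IVar k => nth 0%N env k
  | IConst c => c
  | IAdd a b => (ieval env a + ieval env b)%N
  | ISub a b => (ieval env a - ieval env b)%N
  | IMul a b => (ieval env a * ieval env b)%N
  end.

(* The inverse of 0 is 0, so that inversion also provides a test for 0;
   sqrtC is the principal square root. *)
Fixpoint ceval (R : realType) (env : seq nat) (mem : nat -> R[i]) (e : cexp) :
    R[i] :=
  match e with
  | CCell a => mem (ieval env a)
  | CNat a => (ieval env a)%:R
  | CRoot a => exp_ipi R (ieval env a)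
  | CAdd e1 e2 => ceval env mem e1 + ceval env mem e2
  | COpp e1 => - ceval env mem e1
  | CMul e1 e2 => ceval env mem e1 * ceval env mem e2
  | CInv e1 => (ceval env mem e1)^-1
  | CConj e1 => Num.conj (ceval env mem e1)
  | CSqrt e1 => sqrtC (ceval env mem e1)
  end.

Fixpoint exec (R : realType) (env : seq nat) (P : prog) (mem : nat -> R[i]) :
    nat -> R[i] :=
  match P with
  | Store a e =>
      fun x => if x == ieval env a then ceval env mem e else mem x
  | Seq P1 P2 => exec env P2 (exec env P1 mem)
  | For a P1 =>
      iteri (ieval env a) (fun i mem' => exec (i :: env) P1 mem') mem
  end.

(* One unit per index operation, complex operation, store and loop iteration. *)
Fixpoint icost (a : iexp) : nat :=
  match a with
  | IVar _ | IConst _ => 1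
  | IAdd a b | ISub a b | IMul a b => (icost a + icost b).+1
  end.

Fixpoint ccost (e : cexp) : nat :=
  match e with
  | CCell a | CNat a | CRoot a => (icost a).+1
  | CAdd e1 e2 | CMul e1 e2 => (ccost e1 + ccost e2).+1
  | COpp e1 | CInv e1 | CConj e1 | CSqrt e1 => (ccost e1).+1
  end.

Fixpoint cost (env : seq nat) (P : prog) : nat :=
  match P with
  | Store a e => (icost a + ccost e).+1
  | Seq P1 P2 => cost env P1 + cost env P2
  | For a P1 => icost a + \sum_(i < ieval env a) (cost (val i :: env) P1).+1
  end.

(* Running time bounded by a polynomial in the size n of the input. *)
Definition efficient (P : prog) : Prop :=
  exists d : nat, forall n : nat, (0 < n)%N -> (cost [:: n] P <= d * n ^ d)%N.

Section Runs.
Variable R : realType.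

(* The input f(0), ..., f(n-1) is stored in cells 0, ..., n-1. *)
Definition input (f : nat -> R) (n : nat) : nat -> R[i] :=
  fun x => if (x < n)%N then (f x)%:C else 0.

Definition run (P : prog) (f : nat -> R) (n : nat) : nat -> R[i] :=
  exec [:: n] P (input f n).

(* P ends with L in cells 0, ..., n^2-1 and Q in cells n^2, ..., 2n^2-1,
   both in row-major order. *)
Definition outputs (P : prog) (f : nat -> R) n (L Q : 'M[R[i]]_n) : Prop :=
  forall i j : 'I_n,
    L i j = run P f n (i * n + j)%N /\
    Q i j = run P f n (n * n + (i * n + j))%N.

End Runs.

(* Main.v *)
(* M_f is the top left block of the circulant matrix of order 2n with symbol m_f,
   whose eigenvalues are lam_k = m_f(w^k). Splitting each lam_k as
   sqrt|lam_k| * (lam_k / sqrt|lam_k|) gives M_f = V W with V of size n x 2n and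
   W of size 2n x n, where all rows of V have squared norm S = sum_k |lam_k| and
   all columns of W have squared norm S / (2n)^2. Orthonormalizing the rows of V
   writes V = L U with L lower triangular, L L^* = V V^* and U a partial
   isometry, so M_f = L (U W): L has the row norms of V, and the columns of U W
   are not longer than those of W.

   The program never forms V or W. It computes A = V V^* and M = V W, and then
   eliminates: at step k, column k of L is the pivot column of A and row k of
   Q = U W is the pivot row of M, both divided by sqrt A_kk, and the rank one
   products L_k L_k^* and L_k Q_k are subtracted from A and M. Throughout,
   A = V P V^* and M = V P W for an orthogonal projector P. When A_kk = 0 the
   pivot row of V P vanishes, and with 1/0 = 0 the step does nothing. *)

Require Import Defs.
From HB Require Import structures.
From mathcomp Require Import all_boot all_order all_algebra.
From mathcomp Require Import complex.
From mathcomp Require Import all_classical all_reals all_analysis.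
From mathcomp Require Import zify ring lra.

Set Implicit Arguments.
Unset Strict Implicit.
Unset Printing Implicit Defensive.

Import Order.TTheory GRing.Theory Num.Theory.
Local Open Scope ring_scope.

(** * Running time *)

(** As [N >= 2], one extra factor [N] absorbs a sum of two powers, so all cost bounds stay single
    powers of [N]. *)
Lemma leq_add_expn N d e x y :
  (1 < N -> x <= N ^ d -> y <= N ^ e -> x + y <= N ^ (d + e).+1)%N.
Proof.
move=> N1 xd ye; have N0 : (0 < N)%N by exact: ltnW.
apply: (@leq_trans (2 * N ^ (d + e))).
  rewrite mul2n -addnn; apply: leq_add.
    by apply: (leq_trans xd); rewrite leq_exp2l ?leq_addr.
  by apply: (leq_trans ye); rewrite leq_exp2l ?leq_addl.
by rewrite expnS leq_pmul2r // expn_gt0 N0.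
Qed.

Lemma leq_const_expn N c : (1 < N -> c <= N ^ c)%N.
Proof. by move=> N1; apply: ltnW; exact: ltn_expl. Qed.

Lemma ieval_bound (a : iexp) : exists d, forall N env,
  (1 < N)%N -> all (geq N) env -> (ieval env a <= N ^ d)%N.
Proof.
elim: a => [k|c|a [d Hd] b [e He]|a [d Hd] b [e He]|a [d Hd] b [e He]] /=.
- exists 1%N => N env N1 /allP envN; rewrite expn1.
  case: (ltnP k (size env)) => [kl|kg]; first exact/envN/mem_nth.
  by rewrite nth_default.
- by exists c => N env N1 _; exact: leq_const_expn.
- by exists (d + e).+1 => N env N1 envN; apply: leq_add_expn => //; auto.
- exists d => N env N1 envN; apply: leq_trans (Hd _ _ N1 envN).
  exact: leq_subr.
- by exists (d + e)%N => N env N1 envN; rewrite expnD leq_mul ?Hd ?He.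
Qed.

Lemma cost_bound (P : prog) : exists d, forall N env,
  (1 < N)%N -> all (geq N) env -> (cost env P <= N ^ d)%N.
Proof.
elim: P => [a e|P [d Hd] Q [e He]|a P [e He]] /=.
- by exists (icost a + ccost e).+1 => N env N1 _; exact: leq_const_expn.
- by exists (d + e).+1 => N env N1 envN; apply: leq_add_expn => //; auto.
have [d Hd] := ieval_bound a.
exists (icost a + (d + (d.+1 * e + 1).+1)).+1 => N env N1 envN.
have N0 : (0 < N)%N by exact: ltnW.
apply: leq_add_expn => //; first exact: leq_const_expn.
have aN := Hd _ _ N1 envN.
rewrite expnD; apply: (@leq_trans (\sum_(i < ieval env a) N ^ (d.+1 * e + 1).+1)).
  apply: leq_sum => i _; rewrite -addn1; apply: leq_add_expn; rewrite ?expn1 //.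
  (* Inside the loop all counters are at most [N ^ d.+1], which serves as the new base; [d.+1]
     instead of [d] keeps it above 1. *)
  rewrite expnM; apply: He => /=.
    by rewrite -[X in (X < _)%N](exp1n d.+1) ltn_exp2r.
  apply/andP; split.
    apply: ltnW; apply: leq_trans (ltn_ord i) (leq_trans aN _).
    by rewrite leq_exp2l.
  apply/allP => k /(allP envN) /= kN; apply: (leq_trans kN).
  by rewrite -[X in (X <= _)%N]expn1 leq_exp2l.
by rewrite sum_nat_const card_ord leq_mul2r aN orbT.
Qed.

(* Loop bounds are polynomials in the enclosing counters, and these are bounded
   by powers of the input size. *)
Lemma prog_efficient (P : prog) : efficient P.
Proof.
(* The base is [n.+1] because [n] may be 1. Then [n.+1 <= 2 * n], and [2 ^ d] serves as the factor
   and, exceeding [d], as the exponent. *)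
have [d Hd] := cost_bound P; exists (2 ^ d)%N => n n0.
apply: leq_trans (Hd n.+1 [:: n] _ _) _ => //=; first by rewrite leqnSn.
apply: (@leq_trans ((2 * n) ^ d)).
  by case: d {Hd} => // d; rewrite leq_exp2r //; lia.
by rewrite expnMn leq_pmul2l ?expn_gt0 // leq_pexp2l // ltnW // ltn_expl.
Qed.

(** * Loops filling an array *)

Lemma iteri_ind T (Inv : nat -> T -> Prop) n f x :
  Inv 0%N x -> (forall i y, (i < n)%N -> Inv i y -> Inv i.+1 (f i y)) ->
  Inv n (iteri n f x).
Proof.
move=> I0; elim: n => //= n IHn Istep.
by apply: (Istep) => //; apply: IHn => i y i_n; apply: Istep; exact: ltnW.
Qed.

(* Iteration (i, j) may read its own cell and every cell outside the array. *)
Lemma iteri2_fill T m n (a : nat -> nat -> nat) (g : nat -> nat -> T)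
    (body : nat -> nat -> (nat -> T) -> nat -> T) mem0 :
  (forall i j i' j', (i < m)%N -> (j < n)%N -> (i' < m)%N -> (j' < n)%N ->
     a i j = a i' j' -> i = i' /\ j = j') ->
  (forall i j mem, (i < m)%N -> (j < n)%N ->
     (forall x, (forall i' j', (i' < m)%N -> (j' < n)%N -> x = a i' j' ->
        i' = i /\ j' = j) -> mem x = mem0 x) ->
     forall x, body i j mem x = if x == a i j then g i j else mem x) ->
  let res := iteri m (fun i => iteri n (body i)) mem0 in
  (forall i j, (i < m)%N -> (j < n)%N -> res (a i j) = g i j) /\
  (forall x, (forall i j, (i < m)%N -> (j < n)%N -> x <> a i j) ->
     res x = mem0 x).
Proof.
move=> inj_a bodyE res.
(* Lexicographic order: the cells already filled when iteration [(i0, j0)] starts. *)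
pose done i0 j0 i j := (i < i0)%N || (i == i0) && (j < j0)%N.
pose Inv i0 j0 (mem : nat -> T) :=
  (forall i j, (i < m)%N -> (j < n)%N ->
     mem (a i j) = if done i0 j0 i j then g i j else mem0 (a i j)) /\
  (forall x, (forall i j, (i < m)%N -> (j < n)%N -> x <> a i j) ->
     mem x = mem0 x).
suff [resE resN] : Inv m 0%N res.
  by split=> // i j im jn; rewrite resE // /done im.
rewrite /res; apply: (@iteri_ind _ (fun i0 => Inv i0 0%N)).
  by split=> // i j im jn; rewrite /done andbF.
move=> i0 mem i0m Imem.
suff [rE rN] : Inv i0 n (iteri n (body i0) mem).
  split=> // i j im jn; rewrite rE // /done jn andbT andbF orbF.
  by rewrite ltnS (leq_eqVlt i) orbC.
apply: (@iteri_ind _ (Inv i0)) => // j0 mem' j0n [I1 I2].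
have unread y : (forall i j, (i < m)%N -> (j < n)%N -> y = a i j ->
    i = i0 /\ j = j0) -> mem' y = mem0 y.
  move=> ny; have [[i [j [im jn yE]]]|no] :=
    pselect (exists i j, [/\ (i < m)%N, (j < n)%N & y = a i j]); last first.
    by apply: I2 => i j im jn yE; apply: no; exists i, j.
  have [ei ej] := ny _ _ im jn yE.
  by rewrite yE I1 // /done ei ej !ltnn andbF.
split=> [i j im jn|x nx]; rewrite (bodyE _ _ _ i0m j0n unread).
  case: eqP => [/inj_a [] // -> ->|ne]; first by rewrite /done eqxx leqnn orbT.
  rewrite I1 // /done ltnS (leq_eqVlt j).
  case: (eqVneq i i0) => [ei|//]; case: (eqVneq j j0) => [ej|//].
  by case: ne; rewrite ei ej.
by case: eqP => [/(nx _ _ i0m j0n)//|_]; exact: I2.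
Qed.

(** * Elimination *)

Section Elimination.
Variables (C : numClosedFieldType) (n m : nat).
Variables (V : 'M[C]_(n, m)) (W : 'M[C]_(m, n)).
Local Open Scope sesquilinear_scope.

Lemma trmxC_mul p q r (A : 'M[C]_(p, q)) (B : 'M[C]_(q, r)) :
  (A *m B)^t* = B^t* *m A^t*.
Proof. by rewrite trmx_mul map_mxM. Qed.

Lemma trmxCZ p q a (A : 'M[C]_(p, q)) : (a *: A)^t* = a^* *: A^t*.
Proof. by apply/matrixP => i j; rewrite !mxE rmorphM. Qed.

Lemma mulmx_trmxCE p q (A : 'M[C]_(p, q)) i j :
  (A *m A^t*) i j = \sum_k A i k * (A j k)^*.
Proof. by rewrite mxE; apply: eq_bigr => k _; rewrite !mxE. Qed.

Lemma mulmx_trmxC_ge0 p q (A : 'M[C]_(p, q)) i : 0 <= (A *m A^t*) i i.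
Proof.
by rewrite mulmx_trmxCE; apply: sumr_ge0 => k _; exact: mul_conjC_ge0.
Qed.

Lemma row_trmxC_eq0 p (x : 'rV[C]_p) : (x *m x^t*) 0 0 = 0 -> x = 0.
Proof.
rewrite mulmx_trmxCE => /psumr_eq0P x0; apply/rowP => k; rewrite mxE.
apply/eqP; rewrite -mul_conjC_eq0; apply/eqP/x0 => // i _.
exact: mul_conjC_ge0.
Qed.

(* [P] projects onto the orthogonal complement of the normalized pivot rows;
   columns [j >= k] of [L] and rows [j >= k] of [Q] are unconstrained. *)
Definition elim_inv (k : nat) (L Q A M : 'M[C]_n) := exists P : 'M[C]_m,
  [/\ P *m P = P, P^t* = P, A = V *m P *m V^t*, M = V *m P *m W &
  [/\ forall j : 'I_n, (j < k)%N -> row j (V *m P) = 0,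
      forall i j : 'I_n, (i < j)%N -> (j < k)%N -> L i j = 0,
      \sum_(j < n | (j < k)%N) col j L *m row j Q = V *m (1%:M - P) *m W,
      \sum_(j < n | (j < k)%N) col j L *m (col j L)^t*
        = V *m (1%:M - P) *m V^t* &
      \sum_(j < n | (j < k)%N) (row j Q)^t* *m row j Q
        = W^t* *m (1%:M - P) *m W]].

Lemma elim_inv0 L Q : elim_inv 0 L Q (V *m V^t*) (V *m W).
Proof.
exists 1%:M; rewrite mulmx1 subrr !mulmx0 !mul0mx !big_pred0 //.
by split=> //; rewrite ?mulmx1 // trmx1 map_mx1.
Qed.

(** Let [u] be the pivot row of [V *m P] divided by its norm. The step replaces [P] by
    [P - u^t* *m u], removing the line of [u] from its range; a zero pivot gives [u = 0] and keeps
    [P]. Each sum of the invariant grows by the rank one term coming from [u]. *)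
Lemma elim_invS (k : 'I_n) (L Q A M L' Q' A' M' : 'M[C]_n) :
  (forall i j, L' i j = if j == k then A i k * (sqrtC (A k k))^-1 else L i j) ->
  (forall i j, Q' i j = if i == k then M k j * (sqrtC (A k k))^-1 else Q i j) ->
  (forall i j, A' i j = A i j - L' i k * (L' j k)^*) ->
  (forall i j, M' i j = M i j - L' i k * Q' k j) ->
  elim_inv k L Q A M -> elim_inv k.+1 L' Q' A' M'.
Proof.
move=> L'E Q'E A'E M'E [P [PP Ph AE ME [VP0 Ltrig sumLQ sumLL sumQQ]]].
set d := (sqrtC (A k k))^-1 in L'E Q'E.
pose X := V *m P; pose x := row k X; pose u : 'rV_m := d *: x.
have XP : X *m P = X by rewrite /X -mulmxA PP.
have AX : A = X *m X^t* by rewrite trmxC_mul Ph mulmxA XP.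
have uP : u *m P = u by rewrite -scalemxAl -row_mul XP.
have Pu : P *m u^t* = u^t* by rewrite -{1}Ph -trmxC_mul uP.
have xx : (x *m x^t*) 0 0 = A k k.
  by rewrite AX !mulmx_trmxCE; apply: eq_bigr => i _; rewrite !mxE.
have A0 : 0 <= A k k by rewrite -xx mulmx_trmxC_ge0.
have dC : d^* = d by rewrite conj_Creal // ger0_real // invr_ge0 sqrtC_ge0.
have sq : A k k = sqrtC (A k k) ^+ 2 by rewrite sqrtCK.
(* [A k k] is the squared norm of [x]. A zero pivot forces [x = 0]; otherwise the two factors [d]
   cancel that squared norm. *)
have xux : (x *m u^t*) *m u = x.
  rewrite trmxCZ dC [x *m _]mx11_scalar mul_scalar_mx -scalemxAr mxE xx.
  rewrite scalerA /d; case: (eqVneq (A k k) 0) => [A00|An0].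
    by rewrite [x]row_trmxC_eq0 ?scaler0 // xx.
  have sn0 : sqrtC (A k k) != 0 by rewrite sqrtC_eq0.
  by rewrite {2}sq; set r := sqrtC _ in sn0 *; rewrite -[RHS]scale1r; congr (_ *: _); field.
have uuu : u *m u^t* *m u = u by rewrite {1}/u -!scalemxAl xux.
(* [l] and [q] are the column of [L'] and the row of [Q'] that the step writes; as [u] lies in the
   range of [P], [V *m u^t*] is already [l]. *)
pose l := X *m u^t*; pose q := u *m W.
have Vu : V *m u^t* = l by rewrite /l /X -mulmxA Pu.
have uV : u *m V^t* = l^t* by rewrite -Vu trmxC_mul trmxCK.
have lE i : l i 0 = A i k * d.
  rewrite /l trmxCZ dC -scalemxAr mxE mulrC AX !mxE; congr (_ * _).
  by apply: eq_bigr => c _; rewrite !mxE.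
have qE j : q 0 j = M k j * d.
  by rewrite /q -scalemxAl mxE mulrC /x -row_mul ME mxE.
have colL' : col k L' = l.
  by apply/colP => i; rewrite mxE L'E eqxx lE.
have rowQ' : row k Q' = q.
  by apply/rowP => j; rewrite mxE Q'E eqxx qE.
have colL j : j != k -> col j L' = col j L.
  by move=> /negPf jk; apply/colP => i; rewrite !mxE L'E jk.
have rowQ j : j != k -> row j Q' = row j Q.
  by move=> /negPf jk; apply/rowP => i; rewrite !mxE Q'E jk.
have sumS p r (F F' : 'I_n -> 'M[C]_(p, r)) :
    (forall j, j != k -> F' j = F j) ->
    \sum_(j < n | (j < k.+1)%N) F' j = \sum_(j < n | (j < k)%N) F j + F' k.
  move=> FE; rewrite (bigD1 k) ?leqnn //= addrC; congr (_ + _).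
  apply: eq_big => [j|j /andP[_]]; last exact: FE.
  by rewrite ltnS ltn_neqAle andbC.
pose P' := P - u^t* *m u.
have P'E p r (B : 'M[C]_(p, m)) (D : 'M[C]_(m, r)) :
    B *m P' *m D = B *m P *m D - (B *m u^t*) *m (u *m D).
  by rewrite mulmxBr mulmxBl !mulmxA.
have P'1E p r (B : 'M[C]_(p, m)) (D : 'M[C]_(m, r)) :
    B *m (1%:M - P') *m D = B *m (1%:M - P) *m D + (B *m u^t*) *m (u *m D).
  by rewrite !(mulmxBr, mulmxBl) !mulmxA opprB addrCA addrC -!addrA.
exists P'; split.
- rewrite /P' mulmxBr !mulmxBl PP -mulmxA uP !mulmxA Pu -2!mulmxA [u *m _]mulmxA uuu.
  by rewrite subrr subr0.
- rewrite /P' linearB /= raddfB /= Ph; congr (_ - _).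
  by rewrite [LHS]trmxC_mul trmxCK.
- rewrite P'E -AE Vu uV; apply/matrixP => i j.
  by rewrite A'E !L'E !eqxx -!lE [RHS]mxE [X in _ = _ + X]mxE [X in _ = _ - X]mxE big_ord1 !mxE.
- rewrite P'E -ME Vu; apply/matrixP => i j.
  by rewrite M'E L'E Q'E !eqxx -lE -qE [RHS]mxE [X in _ = _ + X]mxE [X in _ = _ - X]mxE big_ord1.
split.
- move=> j; rewrite ltnS leq_eqVlt => jk.
  rewrite row_mul mulmxBr -row_mul mulmxA -row_mul Vu.
  case/orP: jk => [/eqP/val_inj->|jk]; first by rewrite /l (row_mul _ X) xux subrr.
  by rewrite /l (row_mul _ X) (VP0 _ jk) !mul0mx subrr.
(* The rows of [V *m P] above the pivot vanish by the invariant, so column [k] of [L'] is zero above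
   the diagonal. *)
- move=> i j ij; rewrite ltnS leq_eqVlt L'E => /orP[/eqP/val_inj jk|jk].
    rewrite jk eqxx -lE; move: ij; rewrite jk => /VP0 X0.
    have -> : l i 0 = (row i X *m u^t*) 0 0 by rewrite -row_mul [RHS]mxE.
    by rewrite X0 mul0mx mxE.
  by rewrite -val_eqE /= ltn_eqF //; exact: Ltrig.
- rewrite P'1E -sumLQ Vu -/q -colL' -rowQ' (sumS _ _ (fun j => col j L *m row j Q)) // => j jk.
  by rewrite colL ?rowQ.
- rewrite P'1E -sumLL Vu uV -colL'
    (sumS _ _ (fun j => col j L *m (col j L)^t*)) // => j jk.
  by rewrite colL.
- rewrite P'1E -sumQQ -trmxC_mul -/q -rowQ'
    (sumS _ _ (fun j => (row j Q)^t* *m row j Q)) // => j jk.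
  by rewrite rowQ.
Qed.

(** After [n] steps [V *m P = 0], so [1%:M - P] fixes the rows of [V] and drops out of the first two
    sums. In the third it remains, and [W^t* *m W] exceeds [Q^t* *m Q] by the Gram matrix of the
    columns of [P *m W]. *)
Lemma elim_invn L Q A M : elim_inv n L Q A M ->
  [/\ V *m W = L *m Q, V *m V^t* = L *m L^t*,
      forall i j : 'I_n, (i < j)%N -> L i j = 0 &
      forall j, (Q^t* *m Q) j j <= (W^t* *m W) j j].
Proof.
case=> P [PP Ph AE ME [VP0 Ltrig sumLQ sumLL sumQQ]].
have VP : V *m P = 0.
  by apply/row_matrixP => j; rewrite VP0 // row0.
have V1P : V *m (1%:M - P) = V by rewrite mulmxBr VP subr0 mulmx1.
rewrite V1P in sumLQ sumLL; split.
- rewrite -sumLQ; apply/matrixP => i j; rewrite summxE mxE.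
  by apply: eq_big => k; rewrite ?ltn_ord // => _; rewrite [LHS]mxE big_ord1 !mxE.
- rewrite -sumLL; apply/matrixP => i j; rewrite summxE mxE.
  by apply: eq_big => k; rewrite ?ltn_ord // => _; rewrite [LHS]mxE big_ord1 !mxE.
- by move=> i j ij; exact: Ltrig.
move=> j; have -> : Q^t* *m Q = W^t* *m (1%:M - P) *m W.
  rewrite -sumQQ; apply/matrixP => a b; rewrite summxE mxE.
  by apply: eq_big => k; rewrite ?ltn_ord // => _; rewrite [RHS]mxE big_ord1 !mxE.
rewrite mulmxBr mulmx1 mulmxBl [leLHS]mxE [X in _ + X]mxE lerBlDr lerDl.
rewrite -PP -{1}Ph mulmxA -trmxC_mul -mulmxA.
have := @mulmx_trmxC_ge0 _ _ ((P *m W)^t*) j.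
by rewrite trmxCK.
Qed.
End Elimination.

(** * Roots of unity *)

Local Open Scope complex_scope.

Section Circulant.
Variable R : realType.

Lemma cis_expn (a : R) k :
  (cos a +i* sin a) ^+ k = cos (k%:R * a) +i* sin (k%:R * a).
Proof.
elim: k => [|k IHk]; first by rewrite expr0 mul0r cos0 sin0.
rewrite exprS IHk -natr1 mulrDl mul1r cosD sinD.
by apply/eqP; rewrite eq_complex /=; apply/andP; split; apply/eqP; ring.
Qed.

(** Half-angle formula: [cos x = 1 - 2 sin(x/2)^2], and the sine is positive on []0, pi[]. *)
Lemma cos_neq1 (x : R) : 0 < x -> x < 2 * pi -> cos x != 1.
Proof.
move=> x0 x2; have s0 : 0 < sin (x / 2) by apply: sin_gt0_pi; lra.
have -> : x = x / 2 + x / 2 by field.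
rewrite cosD -!expr2; have := cos2Dsin2 (x / 2); nra.
Qed.

Lemma exp_ipi_prim n : (0 < n)%N -> (2 * n).-primitive_root (exp_ipi R n).
Proof.
move=> n0; have n0R : 0 < n%:R :> R by rewrite ltr0n.
apply/andP; split; first by rewrite muln_gt0.
apply/forallP => i; rewrite unity_rootE /exp_ipi cis_expn.
have piR := pi_gt0 R; case: (eqVneq i.+1 (2 * n)%N) => [->|ne].
  have -> : (2 * n)%:R * (pi / n%:R) = pi + pi :> R.
    by rewrite natrM; field; rewrite gt_eqF.
  by rewrite cosD sinD cospi sinpi !(mulr0, mul0r) addr0 subr0 mulrNN mulr1 !eqxx.
have i2n : (i.+1%:R : R) < 2 * n%:R.
  by rewrite -natrM ltr_nat ltn_neqAle ne ltn_ord.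
apply/eqP/negbTE; rewrite eq_complex negb_and cos_neq1 //.
  by rewrite mulr_gt0 ?divr_gt0.
by rewrite mulrCA mulrC ltr_pM2r // ltr_pdivrMr.
Qed.

Lemma exp_ipi_unit n k : exp_ipi R n ^+ k * (exp_ipi R n ^+ k)^*%R = 1.
Proof.
rewrite rmorphXn -exprMn -[RHS](expr1n _ k); congr (_ ^+ _).
apply/eqP; rewrite eq_complex /=; have := cos2Dsin2 (pi / n%:R : R).
by move=> cs; apply/andP; split; apply/eqP; [apply: etrans cs|]; ring.
Qed.

(** Orthogonality of characters: a geometric series whose ratio [z], in effect [w ^ (s - i)],
    satisfies [z ^+ (2 * n) = 1] and equals 1 only for [s = i], as [w] is primitive. *)
Lemma sum_exp_ipi n s i : (0 < n)%N -> (s < 2 * n)%N -> (i < 2 * n)%N ->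
  \sum_(k < 2 * n) exp_ipi R n ^+ (k * s) * (exp_ipi R n ^+ (k * i))^*%R
    = if s == i then (2 * n)%:R else 0.
Proof.
move=> n0 s2n i2n; have wP := exp_ipi_prim n0; set w := exp_ipi R n in wP *.
pose z := w ^+ s * (w ^+ i)^*%R.
have -> : \sum_(k < 2 * n) w ^+ (k * s) * (w ^+ (k * i))^*%R
    = \sum_(k < 2 * n) z ^+ k.
  by apply: eq_bigr => k _; rewrite exprMn -rmorphXn -!exprM ![(k * _)%N]mulnC.
case: eqVneq => [si|ne].
  under eq_bigr => k _ do rewrite /z si exp_ipi_unit expr1n.
  by rewrite sumr_const card_ord.
have z1 : z - 1 != 0.
  rewrite subr_eq0; apply: contra_neq ne => z1.
  have : w ^+ s = w ^+ i.
    by rewrite -[LHS]mulr1 -(exp_ipi_unit n i) mulrCA -/w -/z z1 mulr1.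
  move/eqP; rewrite (eq_prim_root_expr wP) !modn_small //; exact/eqP.
have w1 t : w ^+ (t * (2 * n)) = 1.
  by rewrite mulnC exprM (prim_expr_order wP) expr1n.
apply: (mulfI z1); rewrite mulr0 -subrX1 /z exprMn -rmorphXn -!exprM !w1.
by rewrite rmorph1 mulr1 subrr.
Qed.

End Circulant.

(** * The program *)

(* Memory is a matrix with n columns, cut into blocks c of n rows: blocks 0 to 3
   hold L, Q, A and M, the powers of w occupy blocks 4 and 5 and the first cell
   of block 6, and the next cell holds the current lam_k. *)
Definition cell (n c i j : nat) : nat := ((c * n + i) * n + j)%N.

Lemma cell_inj n c i j c' i' j' :
  (i < n)%N -> (j < n)%N -> (i' < n)%N -> (j' < n)%N ->
  cell n c i j = cell n c' i' j' -> [/\ c = c', i = i' & j = j'].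
Proof.
have divmod a b d e : (b < n)%N -> (e < n)%N -> (a * n + b = d * n + e)%N ->
    a = d /\ b = e.
  move=> bn en; have n0 : (0 < n)%N by lia.
  move=> /[dup] /(congr1 (divn^~ n)) + /(congr1 (modn^~ n)).
  by rewrite !divnMDl // !divn_small // !modnMDl !modn_small // !addn0.
by move=> ? ? ? ? /divmod[]// /divmod[].
Qed.

Lemma cell_lt n c i j : (i < n)%N -> (j < n)%N ->
  (cell n c i j < cell n c.+1 0 0)%N.
Proof. rewrite /cell; nia. Qed.

Lemma leq_cell n c c' i j : (c <= c')%N -> (cell n c 0 0 <= cell n c' i j)%N.
Proof. rewrite /cell; nia. Qed.

Definition cell_exp (n : iexp) (c : nat) (i j : iexp) : iexp :=
  IAdd (IMul (IAdd (IMul (IConst c) n) i) n) j.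

(* [d] is the de Bruijn index of the size of the input; inside [e] the row and
   the column are [IVar 1] and [IVar 0]. *)
Definition block_loop (d c : nat) (e : cexp) : prog :=
  For (IVar d) (For (IVar d.+1)
    (Store (cell_exp (IVar d.+2) c (IVar 1) (IVar 0)) e)).

(** * Effect of array loops and of the elimination phase on the memory *)

Section Semantics.
Variable R : realType.
Implicit Types (mem : nat -> R[i]) (env : seq nat).

Lemma exec_block_loop env d c e (g : nat -> nat -> R[i]) mem :
  let n := nth 0%N env d in
  (forall i j mem', (i < n)%N -> (j < n)%N ->
     (forall x, (forall i' j', (i' < n)%N -> (j' < n)%N ->
        x = cell n c i' j' -> i' = i /\ j' = j) -> mem' x = mem x) ->
     ceval [:: j, i & env] mem' e = g i j) ->
  let res := exec env (block_loop d c e) mem in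
  (forall i j, (i < n)%N -> (j < n)%N -> res (cell n c i j) = g i j) /\
  (forall x, (forall i j, (i < n)%N -> (j < n)%N -> x <> cell n c i j) ->
     res x = mem x).
Proof.
move=> n eE res; apply: (@iteri2_fill _ n n (cell n c) g
  (fun i j => exec [:: j, i & env] (Store _ e)) mem).
  by move=> i j i' j' im jn im' jn' /cell_inj[] // _ -> ->.
move=> i j mem' im jn H x /=; rewrite -/n -/(cell n c i j).
by case: eqP => // _; exact: eE.
Qed.

Lemma exec_loop env d (e : iexp) v (a : nat -> nat) (g : nat -> R[i]) mem :
  let n := nth 0%N env d in
  (forall i, ieval (i :: env) e = a i) ->
  (forall i i', (i < n)%N -> (i' < n)%N -> a i = a i' -> i = i') ->
  (forall i mem', (i < n)%N ->
     (forall x, (forall i', (i' < n)%N -> x = a i' -> i' = i) ->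
        mem' x = mem x) ->
     ceval (i :: env) mem' v = g i) ->
  let res := exec env (For (IVar d) (Store e v)) mem in
  (forall i, (i < n)%N -> res (a i) = g i) /\
  (forall x, (forall i, (i < n)%N -> x <> a i) -> res x = mem x).
Proof.
move=> n aE inj_a vE res.
have [] := @iteri2_fill _ n 1 (fun i _ => a i) (fun i _ => g i)
  (fun i _ => exec (i :: env) (Store e v)) mem.
- by move=> i [] // i' [] // ? _ ? _ /inj_a ->.
- move=> i [|//] mem' im _ H x /=; rewrite aE; case: eqP => // _; apply: vE => // y Hy.
  by apply: H => i' [|//] im' _ /(Hy _ im') ->.
move=> H1 H2; split=> [i im|x Hx]; first exact: (H1 i 0%N).
by apply: H2 => i j im _; exact: Hx.
Qed.

Definition blk n c mem : 'M[R[i]]_n := \matrix_(i, j) mem (cell n c i j).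

(** [d] is the de Bruijn index of the size; the elimination counter is one loop further in, hence
    [d.-1]. *)
Definition pivot_scaled (d c : nat) (i j : iexp) : cexp :=
  let n := IVar d in let k := IVar d.-1 in
  CMul (CCell (cell_exp n c i j)) (CInv (CSqrt (CCell (cell_exp n 2 k k)))).

(** [L] and [Q] are written first, since both read the old pivot. The updates of [A] and [M] then
    use the stored column and row, so an in-place iteration reads no other entry of the block it
    overwrites. *)
Definition elim_body : prog :=
  Seq (For (IVar 1) (Store (cell_exp (IVar 2) 0 (IVar 0) (IVar 1))
         (pivot_scaled 2 2 (IVar 0) (IVar 1))))
  (Seq (For (IVar 1) (Store (cell_exp (IVar 2) 1 (IVar 1) (IVar 0))
         (pivot_scaled 2 3 (IVar 1) (IVar 0))))
  (Seq (block_loop 1 2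
         (CAdd (CCell (cell_exp (IVar 3) 2 (IVar 1) (IVar 0)))
           (COpp (CMul (CCell (cell_exp (IVar 3) 0 (IVar 1) (IVar 2)))
             (CConj (CCell (cell_exp (IVar 3) 0 (IVar 0) (IVar 2))))))))
       (block_loop 1 3
         (CAdd (CCell (cell_exp (IVar 3) 3 (IVar 1) (IVar 0)))
           (COpp (CMul (CCell (cell_exp (IVar 3) 0 (IVar 1) (IVar 2)))
             (CCell (cell_exp (IVar 3) 1 (IVar 2) (IVar 0))))))))).

Lemma exec_elim_body n m (V : 'M[R[i]]_(n, m)) (W : 'M[R[i]]_(m, n)) (k : 'I_n) mem :
  elim_inv V W k (blk n 0 mem) (blk n 1 mem) (blk n 2 mem) (blk n 3 mem) ->
  let mem' := exec [:: val k; n] elim_body mem in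
  elim_inv V W k.+1 (blk n 0 mem') (blk n 1 mem') (blk n 2 mem') (blk n 3 mem').
Proof.
have kn : (k < n)%N := ltn_ord k.
have neq c i j c' i' j' : (i < n)%N -> (j < n)%N -> (i' < n)%N -> (j' < n)%N ->
    c != c' -> cell n c i j <> cell n c' i' j'.
  by move=> ? ? ? ? /eqP ne /cell_inj[].
rewrite /elim_body; set P1 := For _ _; set P2 := For _ _.
set P3 := block_loop _ _ _; set P4 := block_loop _ _ _.
move=> inv.
rewrite -[exec _ (Seq _ _) _]/(exec [:: val k; n] P4
  (exec [:: val k; n] P3 (exec [:: val k; n] P2 (exec [:: val k; n] P1 mem)))).
set m1 := exec _ P1 mem; set m2 := exec _ P2 m1; set m3 := exec _ P3 m2.
set m4 := exec _ P4 m3.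
have [L1 N1] : (forall i, (i < n)%N -> m1 (cell n 0 i k)
      = mem (cell n 2 i k) * (sqrtC (mem (cell n 2 k k)))^-1) /\
    (forall x, (forall i, (i < n)%N -> x <> cell n 0 i k) -> m1 x = mem x).
  apply: (@exec_loop [:: val k; n] 1 _ _ (fun i => cell n 0 i k)
    (fun i => mem (cell n 2 i k) * _)) => // [i i' im im' /cell_inj[]//|].
  move=> i mem' im H /=.
  by rewrite -!/(cell n 2 _ k) !H // => i' im' /neq; case.
have [Q2 N2] : (forall j, (j < n)%N -> m2 (cell n 1 k j)
      = m1 (cell n 3 k j) * (sqrtC (m1 (cell n 2 k k)))^-1) /\
    (forall x, (forall j, (j < n)%N -> x <> cell n 1 k j) -> m2 x = m1 x).
  apply: (@exec_loop [:: val k; n] 1 _ _ (fun j => cell n 1 k j)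
    (fun j => m1 (cell n 3 k j) * _)) => // [i i' im im' /cell_inj[]//|].
  move=> i mem' im H /=.
  by rewrite -!/(cell n _ _ _) !H // => i' im' /neq; case.
have [A3 N3] : (forall i j, (i < n)%N -> (j < n)%N -> m3 (cell n 2 i j)
      = m2 (cell n 2 i j) - m2 (cell n 0 i k) * (m2 (cell n 0 j k))^*%R) /\
    (forall x, (forall i j, (i < n)%N -> (j < n)%N -> x <> cell n 2 i j) ->
      m3 x = m2 x).
  apply: (@exec_block_loop [:: val k; n] 1 2 _ (fun i j => _))
    => i j mem' im jm H /=; rewrite -!/(cell n _ _ _).
  by rewrite !H // => i' j' im' jm' /cell_inj[].
have [M4 N4] : (forall i j, (i < n)%N -> (j < n)%N -> m4 (cell n 3 i j)
      = m3 (cell n 3 i j) - m3 (cell n 0 i k) * m3 (cell n 1 k j)) /\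
    (forall x, (forall i j, (i < n)%N -> (j < n)%N -> x <> cell n 3 i j) ->
      m4 x = m3 x).
  apply: (@exec_block_loop [:: val k; n] 1 3 _ (fun i j => _))
    => i j mem' im jm H /=; rewrite -!/(cell n _ _ _).
  by rewrite !H // => i' j' im' jm' /cell_inj[].
(* Frame facts: each phase changes a single block. *)
have e1 c i j : (i < n)%N -> (j < n)%N -> c != 0%N ->
    m1 (cell n c i j) = mem (cell n c i j).
  by move=> im jm c0; rewrite N1 // => i' im'; exact: neq.
have e2 c i j : (i < n)%N -> (j < n)%N -> c != 1%N ->
    m2 (cell n c i j) = m1 (cell n c i j).
  by move=> im jm c0; rewrite N2 // => i' im'; exact: neq.
have e3 c i j : (i < n)%N -> (j < n)%N -> c != 2 ->
    m3 (cell n c i j) = m2 (cell n c i j).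
  by move=> im jm c0; rewrite N3 // => i' j' im' jm'; exact: neq.
have e4 c i j : (i < n)%N -> (j < n)%N -> c != 3 ->
    m4 (cell n c i j) = m3 (cell n c i j).
  by move=> im jm c0; rewrite N4 // => i' j' im' jm'; exact: neq.
apply: elim_invS inv => i j; rewrite !mxE.
- rewrite e4 // e3 // e2 //; case: eqP => [->|ne]; first exact: L1.
  by rewrite N1 // => i' im' /cell_inj[] // _ _ /val_inj.
- rewrite e4 // e3 //; case: eqP => [->|ne]; first by rewrite Q2 // !e1.
  by rewrite N2 ?e1 // => j' jm' /cell_inj[] // _ /val_inj.
- by rewrite e4 // A3 // e2 // e1 // [m4 (cell n 0 i k)]e4 ?e3 // e4 ?e3.
- by rewrite M4 // ![m4 _]e4 // e3 // e2 // e1.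
Qed.

(** Nothing is asked of blocks 0 and 1 at the start: the input still occupies the first row of block
    0, and the loop overwrites it column by column. *)
Lemma exec_elim_loop n m (V : 'M[R[i]]_(n, m)) (W : 'M[R[i]]_(m, n)) mem :
  blk n 2 mem = V *m (map_mx Num.conj V^T) -> blk n 3 mem = V *m W ->
  let mem' := exec [:: n] (For (IVar 0) elim_body) mem in
  elim_inv V W n (blk n 0 mem') (blk n 1 mem') (blk n 2 mem') (blk n 3 mem').
Proof.
move=> AE ME /=.
apply: (@iteri_ind _ (fun k mem => elim_inv V W k
  (blk n 0 mem) (blk n 1 mem) (blk n 2 mem) (blk n 3 mem))).
  by rewrite AE ME; exact: elim_inv0.
by move=> k mem' kn; exact: (@exec_elim_body _ _ _ _ (Ordinal kn)).
Qed.
End Semantics.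

(** * Text of the program: roots of unity, spectral sums, elimination *)

Definition root_cell (d : nat) (t : iexp) : iexp := cell_exp (IVar d) 4 (IConst 0) t.

Definition lam_cell (d : nat) : iexp := cell_exp (IVar d) 6 (IConst 0) (IConst 1).

(** The exponents needed are [k * i] with [k < 2n] and [i < n], so a table up to [2n^2] avoids
    reduction modulo [2n]. It is addressed linearly, with a column index running past the width
    [n]. *)
Definition root_table : prog :=
  Seq (Store (root_cell 0 (IConst 0)) (CNat (IConst 1)))
      (For (IMul (IConst 2) (IMul (IVar 0) (IVar 0)))
        (Store (root_cell 1 (IAdd (IVar 0) (IConst 1)))
           (CMul (CCell (root_cell 1 (IVar 0))) (CRoot (IVar 1))))).

(** The matrix added is a multiple of the top left block of the rank one matrix of the [k]-th
    Fourier mode, an eigenvector of the circulant. *)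
Definition add_harmonic (c : nat) (e : cexp) : prog :=
  block_loop 1 c (CAdd (CCell (cell_exp (IVar 3) c (IVar 1) (IVar 0)))
    (CMul e (CMul (CConj (CCell (root_cell 3 (IMul (IVar 2) (IVar 1)))))
                  (CCell (root_cell 3 (IMul (IVar 2) (IVar 0))))))).

Definition eval_symbol : prog :=
  Seq (Store (lam_cell 1) (CNat (IConst 0)))
      (For (IVar 1) (Store (lam_cell 2) (CAdd (CCell (lam_cell 2))
         (CMul (CCell (IVar 0)) (CCell (root_cell 2 (IMul (IVar 1) (IVar 0)))))))).

(** The [k]-th terms of [V V^*] and of [V W], with weights [|lam_k|] and [lam_k / (2n)]; the modulus
    is obtained as the root of [lam_k] times its conjugate. *)
Definition spectral_body : prog :=
  Seq eval_symbol
  (Seq (add_harmonic 2 (CSqrt (CMul (CCell (lam_cell 3)) (CConj (CCell (lam_cell 3))))))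
       (add_harmonic 3 (CMul (CInv (CNat (IMul (IConst 2) (IVar 3)))) (CCell (lam_cell 3))))).

Definition factorization_prog : prog :=
  Seq root_table
  (Seq (For (IMul (IConst 2) (IVar 0)) spectral_body)
       (For (IVar 0) elim_body)).

(** * Memory contents after each phase *)

Section Correctness.
Variables (R : realType) (f : nat -> R) (n : nat).
Hypothesis n_gt0 : (0 < n)%N.
Implicit Types mem : nat -> R[i].

Let w : R[i] := exp_ipi R n.
Let lam (k : nat) : R[i] := (m_ f n).[w ^+ k].
Let chi (k i j : nat) : R[i] := (w ^+ (k * i))^*%R * w ^+ (k * j).

Definition tabulated mem :=
  (forall t, (t <= 2 * (n * n))%N -> mem (cell n 4 0 t) = w ^+ t) /\
  (forall t, (t < n)%N -> mem t = (f t)%:C).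

Lemma tabulated_eq mem mem' :
  (forall x, (x < cell n 1 0 0)%N || (cell n 4 0 0 <= x <= cell n 6 0 0)%N ->
     mem' x = mem x) ->
  tabulated mem -> tabulated mem'.
Proof.
by move=> mE [Hw Hf]; split=> t tn; (rewrite mE ?Hw ?Hf //); rewrite /cell; nia.
Qed.

Lemma exec_root_table : tabulated (exec [:: n] root_table (input f n)) /\
  forall x, (x < cell n 4 0 0)%N ->
    exec [:: n] root_table (input f n) x = input f n x.
Proof.
set mem := exec _ _ _.
have [H1 H2] : (forall t, (t <= 2 * (n * n))%N -> mem (cell n 4 0 t) = w ^+ t) /\
    (forall x, (x < cell n 4 0 0)%N -> mem x = input f n x).
  apply: (@iteri_ind _ (fun u mem => (forall t, (t <= u)%N ->
    mem (cell n 4 0 t) = w ^+ t) /\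
    (forall x, (x < cell n 4 0 0)%N -> mem x = input f n x))).
    split=> [t|x xn] /=; rewrite -/(cell n 4 0 0).
      by rewrite leqn0 => /eqP->; rewrite eqxx expr0.
    by rewrite ltn_eqF.
  move=> u mem' un [I1 I2]; split=> [t tu|x xn] /=.
    rewrite -!/(cell n 4 0 _) I1 // addn1 -/w -exprSr.
    case: eqP => [|ne]; rewrite /cell; first by move/addnI->.
    by rewrite -/(cell n 4 0 t) I1 //; move: ne; rewrite /cell; lia.
  rewrite ltn_eqF; first exact: I2.
  by move: xn; rewrite /cell; lia.
split=> //; split=> // t tn; rewrite H2; first by rewrite /input tn.
by rewrite /cell; nia.
Qed.

Lemma exec_eval_symbol k mem : (k < 2 * n)%N -> tabulated mem ->
  let mem' := exec [:: k; n] eval_symbol mem in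
  mem' (cell n 6 0 1) = lam k /\
  (forall x, x <> cell n 6 0 1 -> mem' x = mem x).
Proof.
move=> kn [Hw Hf] /=.
have -> : lam k = \sum_(0 <= t < n) (f t)%:C * w ^+ (k * t).
  rewrite /lam horner_poly big_mkord; apply: eq_bigr => t _.
  by rewrite exprM.
apply: (@iteri_ind _ (fun u mem' =>
  mem' (cell n 6 0 1) = \sum_(0 <= t < u) (f t)%:C * w ^+ (k * t) /\
  (forall x, x <> cell n 6 0 1 -> mem' x = mem x))).
  split=> [|x xne]; rewrite -/(cell n 6 0 1); first by rewrite big_geq ?eqxx.
  by case: eqP.
move=> t mem' tn [I1 I2]; split=> [|x xne]; rewrite -/(cell n 6 0 1).
  rewrite eqxx I1 big_nat_recr //=; congr (_ + _ * _).
    by rewrite I2 ?Hf // /cell; nia.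
  by rewrite -/(cell n 4 0 (k * t)) I2 ?Hw // /cell; nia.
by case: eqP => // _; exact: I2.
Qed.

(** The hypothesis on [e] makes its value depend only on the cell of [lam_k], which lies outside the
    block being written. *)
Lemma exec_add_harmonic c e v k mem : (1 < c < 4)%N -> (k < 2 * n)%N ->
  tabulated mem ->
  (forall i j mem', (mem' (cell n 6 0 1) = mem (cell n 6 0 1)) ->
     ceval [:: j; i; k; n] mem' e = v) ->
  let mem' := exec [:: k; n] (add_harmonic c e) mem in
  (forall i j, (i < n)%N -> (j < n)%N ->
     mem' (cell n c i j) = mem (cell n c i j) + v * chi k i j) /\
  (forall x, (x < cell n c 0 0)%N || (cell n c.+1 0 0 <= x)%N ->
     mem' x = mem x).
Proof.
move=> /andP[c1 c4] kn [Hw Hf] eE mem'.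
have high i j x : (i < n)%N -> (j < n)%N -> (cell n c.+1 0 0 <= x)%N ->
    x <> cell n c i j.
  by move=> im jm + xE; rewrite xE leqNgt cell_lt.
have [H1 H2] : (forall i j, (i < n)%N -> (j < n)%N ->
     mem' (cell n c i j) = mem (cell n c i j) + v * chi k i j) /\
  (forall x, (forall i j, (i < n)%N -> (j < n)%N -> x <> cell n c i j) ->
     mem' x = mem x).
  apply: (@exec_block_loop _ [:: k; n] 1 c _ (fun i j => _)) => i j mem2 im jm H.
  have kept x : (cell n 4 0 0 <= x)%N -> mem2 x = mem x.
    move=> x4; apply: H => i' j' im' jm' xE; case: (high i' j' x) => //.
    by apply: leq_trans x4; apply: leq_cell.
  have kept6 : mem2 (cell n 6 0 1) = mem (cell n 6 0 1) by rewrite kept ?leq_cell.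
  have kept4 t : mem2 (cell n 4 0 t) = mem (cell n 4 0 t) by rewrite kept ?leq_cell.
  rewrite /= -!/(cell n _ _ _) eE ?kept6 ?kept4 //.
  rewrite !Hw; [|by rewrite mulnA leq_mul // ltnW ..].
  by rewrite H // => i' j' im' jm' /cell_inj[] // _ -> ->.
split=> // x /orP[xc|xc]; apply: H2 => i j im jm; last exact: high.
by move=> xE; move: xc; rewrite xE ltnNge leq_cell.
Qed.

Lemma exec_spectral_loop mem : tabulated mem ->
  (forall x, (cell n 2 0 0 <= x < cell n 4 0 0)%N -> mem x = 0) ->
  let mem' := exec [:: n] (For (IMul (IConst 2) (IVar 0)) spectral_body) mem in
  forall i j, (i < n)%N -> (j < n)%N ->
    mem' (cell n 2 i j) = \sum_(0 <= k < 2 * n) `|lam k| * chi k i j /\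
    mem' (cell n 3 i j)
      = \sum_(0 <= k < 2 * n) ((2 * n)%:R^-1 * lam k) * chi k i j.
Proof.
move=> tab0 z0 mem'.
suff [] : tabulated mem' /\ forall i j, (i < n)%N -> (j < n)%N ->
    mem' (cell n 2 i j) = \sum_(0 <= k < 2 * n) `|lam k| * chi k i j /\
    mem' (cell n 3 i j)
      = \sum_(0 <= k < 2 * n) ((2 * n)%:R^-1 * lam k) * chi k i j by [].
have -> : mem' = iteri (2 * n) (fun k => exec [:: k; n] spectral_body) mem by [].
apply: (@iteri_ind _ (fun K mem' => tabulated mem' /\
  forall i j, (i < n)%N -> (j < n)%N ->
    mem' (cell n 2 i j) = \sum_(0 <= k < K) `|lam k| * chi k i j /\
    mem' (cell n 3 i j)
      = \sum_(0 <= k < K) ((2 * n)%:R^-1 * lam k) * chi k i j)).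
  split=> // i j im jm; rewrite !big_geq // !z0 //.
    by rewrite leq_cell //= (leq_trans (cell_lt _ _ _)).
  by rewrite leq_cell //= (leq_trans (cell_lt _ _ _)) // leq_cell.
move=> k m0 kn [tab Hsum].
rewrite -[exec _ spectral_body _]/(exec [:: k; n] (add_harmonic 3 _)
  (exec [:: k; n] (add_harmonic 2 _) (exec [:: k; n] eval_symbol m0))).
set m1 := exec _ eval_symbol m0; set m2 := exec _ _ m1; set m3 := exec _ _ m2.
have [lam1 N1] : m1 (cell n 6 0 1) = lam k /\
  (forall x, x <> cell n 6 0 1 -> m1 x = m0 x) := exec_eval_symbol kn tab.
have tab1 : tabulated m1.
  by apply: tabulated_eq tab => x xP; rewrite N1 // => xE; move: xP; rewrite xE /cell; lia.
have [A2 N2] : (forall i j, (i < n)%N -> (j < n)%N ->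
     m2 (cell n 2 i j) = m1 (cell n 2 i j) + `|lam k| * chi k i j) /\
    (forall x, (x < cell n 2 0 0)%N || (cell n 3 0 0 <= x)%N -> m2 x = m1 x).
  apply: (@exec_add_harmonic 2 _ _ k m1) => // i j mem2 E /=.
  by rewrite -!/(cell n 6 0 1) E lam1 normC_def.
have tab2 : tabulated m2.
  by apply: tabulated_eq tab1 => x xP; rewrite N2 //; move: xP; rewrite /cell; nia.
have lam2 : m2 (cell n 6 0 1) = lam k by rewrite N2 ?lam1 // orbC leq_cell.
have [A3 N3] : (forall i j, (i < n)%N -> (j < n)%N -> m3 (cell n 3 i j)
      = m2 (cell n 3 i j) + (2 * n)%:R^-1 * lam k * chi k i j) /\
    (forall x, (x < cell n 3 0 0)%N || (cell n 4 0 0 <= x)%N -> m3 x = m2 x).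
  apply: (@exec_add_harmonic 3 _ _ k m2) => // i j mem2 E /=.
  by rewrite -/(cell n 6 0 1) E lam2.
split=> [|i j im jm].
  by apply: tabulated_eq tab2 => x xP; rewrite N3 //; move: xP; rewrite /cell; nia.
have [HA HM] := Hsum _ _ im jm.
have nlam c : (c < 4)%N -> cell n c i j <> cell n 6 0 1.
  by move=> c4 E; have := @cell_lt n c i j im jm; rewrite E ltnNge leq_cell //; lia.
rewrite !big_nat_recr //= -HA -HM; split.
  by rewrite N3 ?cell_lt // A2 // N1 //; exact: nlam.
by rewrite A3 // N2 ?leq_cell ?orbT // N1 //; exact: nlam.
Qed.

(** * The explicit spectral factors and their norms *)

Lemma cabsE (z : R[i]) : (cabs z)%:C = `|z|.
Proof. by rewrite normc_def; case: z. Qed.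

Let S : R := \sum_(0 <= k < 2 * n) cabs (lam k).

Definition spectral_left : 'M[R[i]]_(n, 2 * n) :=
  \matrix_(i, k) (sqrtC `|lam k| * (w ^+ (k * i))^*%R).

(** The normalization [1/(2n)] of the Fourier modes is put entirely on this factor; a zero
    eigenvalue gives a zero row because [0 / 0 = 0]. *)
Definition spectral_right : 'M[R[i]]_(2 * n, n) :=
  \matrix_(k, j) ((2 * n)%:R^-1 * (lam k / sqrtC `|lam k|) * w ^+ (k * j)).

Local Notation V := spectral_left.
Local Notation W := spectral_right.

Lemma sqrtC_norm_conj (z : R[i]) : (sqrtC `|z|)^*%R = sqrtC `|z|.
Proof. by rewrite conj_Creal // ger0_real // sqrtC_ge0. Qed.

Lemma spectral_leftE i j : (V *m map_mx Num.conj V^T) i j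
  = \sum_(0 <= k < 2 * n) `|lam k| * chi k i j.
Proof.
rewrite mulmx_trmxCE big_mkord; apply: eq_bigr => k _; rewrite !mxE.
by rewrite rmorphM /= conjCK sqrtC_norm_conj mulrACA -expr2 sqrtCK.
Qed.

Lemma spectral_mulE i j : (V *m W) i j
  = \sum_(0 <= k < 2 * n) ((2 * n)%:R^-1 * lam k) * chi k i j.
Proof.
rewrite mxE big_mkord; apply: eq_bigr => k _; rewrite !mxE /chi.
case: (eqVneq (lam k) 0) => [->|l0]; first by rewrite !(mul0r, mulr0).
have s0 : sqrtC `|lam k| != 0 by rewrite sqrtC_eq0 normr_eq0.
transitivity ((2 * n)%:R^-1 * (lam k / sqrtC `|lam k| * sqrtC `|lam k|)
  * ((w ^+ (k * i))^*%R * w ^+ (k * j))); first by ring.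
by rewrite divfK.
Qed.

Lemma spectral_right_sqr j : (map_mx Num.conj W^T *m W) j j
  = ((2 * n)%:R^-1 ^+ 2 * S)%:C.
Proof.
rewrite mxE /S rmorphM rmorph_sum /= mulr_sumr big_mkord.
apply: eq_bigr => k _; rewrite !mxE -normCKC !normrM !exprMn.
rewrite [X in _ * X]normCK exp_ipi_unit mulr1 rmorphXn fmorphV rmorph_nat cabsE.
congr (_ * _); first by rewrite ger0_norm // invr_ge0 ler0n.
rewrite normfV exprVn -[X in _ / X]normrX sqrtCK normr_id.
case: (eqVneq (lam k) 0) => [->|l0]; first by rewrite normr0 expr0n mul0r.
by rewrite expr2 mulfK // normr_eq0.
Qed.

(** Order [2n] excludes wrap-around: [t + j < 2n] for [t, j < n], so orthogonality selects exactly
    the term with [t + j = i], which exists only if [j <= i]. *)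
Lemma spectral_factorization : V *m W = map_mx (real_complex R) (M_ f n).
Proof.
apply/matrixP => i j; rewrite spectral_mulE !mxE.
have lamE k : lam k = \sum_(t < n) (f t)%:C * w ^+ (k * t).
  by rewrite /lam horner_poly; apply: eq_bigr => t _; rewrite exprM.
have n0 : (2 * n)%:R != 0 :> R[i] by rewrite pnatr_eq0; lia.
transitivity (\sum_(t < n) (f t)%:C * ((t + j)%N == i)%:R : R[i]).
  under eq_bigr => k _ do rewrite lamE mulr_sumr mulr_suml.
  rewrite big_mkord exchange_big /=; apply: eq_bigr => t _.
  have tj : (t + j < 2 * n)%N by have := ltn_ord t; have := ltn_ord j; lia.
  have i2 : (i < 2 * n)%N by have := ltn_ord i; lia.
  have := sum_exp_ipi R n_gt0 tj i2; rewrite -/w => E.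
  transitivity ((f t)%:C * ((2 * n)%:R^-1 *
      \sum_(k < 2 * n) w ^+ (k * (t + j)) * (w ^+ (k * i))^*%R)).
    rewrite !mulr_sumr; apply: eq_bigr => k _.
    by rewrite /chi mulnDr exprD; ring.
  by rewrite E; case: eqP => _; rewrite ?mulr0 ?mulVf.
case: leqP => ij.
  have ijn : (i - j < n)%N by have := ltn_ord i; lia.
  rewrite (bigD1 (Ordinal ijn)) //= subnK // eqxx mulr1 big1 ?addr0 // => t.
  rewrite -val_eqE /= => ti; case: eqP => [E|_]; last by rewrite mulr0.
  by move: ti; rewrite -E addnK eqxx.
by rewrite big1 ?rmorph0 // => t _; case: eqP => [E|_]; rewrite ?mulr0 //; lia.
Qed.

Lemma run_factorization : exists L Q : 'M[R[i]]_n,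
  [/\ outputs factorization_prog f L Q, map_mx (real_complex R) (M_ f n) = L *m Q,
      is_trig_mx L,
      forall i, gram_diag L i = S &
      forall j, \sum_i cabs (Q i j) ^+ 2 <= (2 * n)%:R^-1 ^+ 2 * S].
Proof.
set mem1 := exec [:: n] root_table (input f n).
set mem2 := exec [:: n] (For (IMul (IConst 2) (IVar 0)) spectral_body) mem1.
set mem3 := exec [:: n] (For (IVar 0) elim_body) mem2.
have [tab1 low1] : tabulated mem1 /\
  (forall x, (x < cell n 4 0 0)%N -> mem1 x = input f n x) := exec_root_table.
(* The accumulators start at 0: the input occupies only [n] cells, before block 2, and the root
   table begins at block 4. *)
have z1 x : (cell n 2 0 0 <= x < cell n 4 0 0)%N -> mem1 x = 0.
  move=> /andP[x2 x4]; rewrite low1 // /input ifF //.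
  by apply/negbTE; move: x2; rewrite /cell; nia.
have mem2E := exec_spectral_loop tab1 z1.
have A2 : blk n 2 mem2 = V *m (map_mx Num.conj V^T).
  by apply/matrixP => i j; rewrite spectral_leftE mxE; have [] := mem2E _ _ (ltn_ord i) (ltn_ord j).
have M2 : blk n 3 mem2 = V *m W.
  by apply/matrixP => i j; rewrite spectral_mulE mxE; have [] := mem2E _ _ (ltn_ord i) (ltn_ord j).
have [VW VV trigL QQ] := elim_invn (exec_elim_loop A2 M2).
exists (blk n 0 mem3), (blk n 1 mem3); split.
- by move=> i j; rewrite !mxE /cell mul0n add0n mul1n (mulnDl n) -addnA.
- by rewrite -spectral_factorization.
- by apply/is_trig_mxP => i j; exact: trigL.
- move=> i; rewrite /gram_diag -VV spectral_leftE.
  have -> : \sum_(0 <= k < 2 * n) `|lam k| * chi k i i = S%:C.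
    rewrite /S rmorph_sum; apply: eq_bigr => k _ /=.
    by rewrite cabsE /chi mulrC [_^*%R * _]mulrC exp_ipi_unit mul1r.
  by [].
- move=> j; rewrite -lecR -(spectral_right_sqr j); apply: le_trans (QQ j).
  rewrite rmorph_sum [leRHS]mxE; apply: ler_sum => i _.
  by rewrite !mxE -normCKC rmorphXn /= cabsE.
Qed.

End Correctness.

(** * Norms *)

Section Norms.
Variable R : realType.

Lemma norm_1to2_ge0 m n (Q : 'M[R[i]]_(m, n)) : 0 <= norm_1to2 Q.
Proof. exact: bigmax_ge_id. Qed.

Lemma Tr_p_ge0 p m n (L : 'M[R[i]]_(m, n)) : 0 <= Tr_p p L.
Proof. by case: p => [q||] //=; [exact: powR_ge0|exact: bigmax_ge_id]. Qed.

Lemma gamma_p_le p d k n (B : 'M[R[i]]_(d, k)) (Q : 'M[R[i]]_(k, n)) :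
  gamma_p p (B *m Q) <= Tr_p p B * norm_1to2 Q.
Proof.
apply: ge_inf; last by exists k, B, Q.
exists 0 => _ [l [B' [Q' [_ ->]]]].
by rewrite mulr_ge0 ?Tr_p_ge0 ?norm_1to2_ge0.
Qed.

Lemma Tr_p_gram_cst (q S : R) d n (L : 'M[R[i]]_(d, n)) : 0 < q -> 0 <= S ->
  (forall i, gram_diag L i = S) -> Tr_p q%:E L = d%:R `^ q^-1 * Num.sqrt S.
Proof.
move=> q0 S0 LS; rewrite /Tr_p; under eq_bigr => i _ do rewrite LS.
rewrite sumr_const card_ord -[_ *+ d]mulr_natl powRM ?ler0n ?powR_ge0 //.
rewrite -powRrM -powR12_sqrt //; congr (_ * _ `^ _); field.
by rewrite gt_eqF.
Qed.

(** Only an inequality, since the maximum is 0 for [d = 0]. *)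
Lemma Tr_oo_gram_cst (S : R) d n (L : 'M[R[i]]_(d, n)) :
  (forall i, gram_diag L i = S) -> Tr_p +oo%E L <= Num.sqrt S.
Proof.
by move=> LS; apply: bigmax_le => [|i _]; rewrite ?LS // sqrtr_ge0.
Qed.

Lemma norm_1to2_le m n (Q : 'M[R[i]]_(m, n)) (c : R) : 0 <= c ->
  (forall j, \sum_i cabs (Q i j) ^+ 2 <= c ^+ 2) -> norm_1to2 Q <= c.
Proof.
move=> c0 Qc; apply: bigmax_le => // j _.
by rewrite -[leRHS]ger0_norm // -sqrtr_sqr ler_wsqrtr.
Qed.

End Norms.

(** * Norm bounds for the computed factors *)

Unset Implicit Arguments.

Theorem theorem1p1 (R : realType) :
  exists P : prog, efficient P /\
  forall (n : nat) (f : nat -> R),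
    (0 < n)%N -> (forall k : nat, 0 <= f k) ->
    let Mf : 'M[R[i]]_n := map_mx (real_complex R) (M_ f n) in
    let w : R[i] := exp_ipi R n in
    let S : R := \sum_(0 <= k < 2 * n) cabs (m_ f n).[w ^+ k] in
    (exists L Q : 'M[R[i]]_n,
      [/\ outputs P f L Q,
          Mf = L *m Q,
          is_trig_mx L
        & forall p : nat, (2 <= p)%N ->
            gamma_p (p%:R)%:E Mf <= Tr_p (p%:R)%:E L * norm_1to2 Q /\
            Tr_p (p%:R)%:E L * norm_1to2 Q
              <= (2 * n%:R `^ (1 - p%:R^-1))^-1 * S]) /\
    gamma_2 Mf <= (2 * n%:R)^-1 * S /\
    gamma_F Mf <= (2 * Num.sqrt n%:R)^-1 * S.
Proof.
exists factorization_prog; split; first exact: prog_efficient.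
move=> n f n0 _ Mf w S.
have S0 : 0 <= S by apply: sumr_ge0 => k _; rewrite -lecR cabsE; exact: normr_ge0.
have [L [Q [outLQ MLQ trigL LS QS]]] := run_factorization f n0.
rewrite -/Mf in MLQ.
have n0R : 0 < n%:R :> R by rewrite ltr0n.
have Q_le : norm_1to2 Q <= (2 * n%:R)^-1 * Num.sqrt S.
  apply: norm_1to2_le => [|j].
    by rewrite mulr_ge0 ?sqrtr_ge0 // invr_ge0 mulr_ge0 // ltW.
  by apply: (le_trans (QS j)); rewrite exprMn sqr_sqrtr // natrM.
have Tr_le p : (2 <= p)%N -> Tr_p (p%:R)%:E L * norm_1to2 Q
    <= (2 * n%:R `^ (1 - p%:R^-1))^-1 * S.
  move=> p2; have p0 : 0 < p%:R :> R by rewrite ltr0n ltnW.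
  apply: (le_trans (ler_wpM2l (Tr_p_ge0 _ _) Q_le)).
  (* Equal row norms give [n^(1/p) * sqrt S] for the trace; multiplying by [sqrt S / (2n)] yields
     [S / (2 n^(1-1/p))]. *)
  rewrite (Tr_p_gram_cst p0 S0 LS) mulrACA -expr2 sqr_sqrtr //.
  rewrite powRB ?(gt_eqF n0R) ?implybT // powRr1 ?(ltW n0R) //.
  rewrite le_eqVlt; apply/orP; left; apply/eqP; field.
  by rewrite !gt_eqF ?powR_gt0.
split; last split.
- exists L, Q; split=> // p p2; split; last exact: Tr_le.
  by rewrite MLQ; exact: gamma_p_le.
- rewrite /gamma_2 MLQ; apply: (le_trans (gamma_p_le _ _ _)).
  apply: (le_trans (ler_pM (Tr_p_ge0 _ _) (norm_1to2_ge0 _)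
    (Tr_oo_gram_cst LS) Q_le)).
  by rewrite mulrCA -expr2 sqr_sqrtr.
- rewrite /gamma_F MLQ; apply: (le_trans (gamma_p_le _ _ _)).
  apply: (le_trans (Tr_le 2 isT)).
  have -> : 1 - 2%:R^-1 = 2^-1 :> R by field.
  by rewrite powR12_sqrt // ltW.
Qed.
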